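(* Suppose that $\{\gamma_n\}_{n\ge 0}$ is a monotone increasing sequence of real numbers, not identically zero, satisfying $\gamma_0=0$ and $$\gamma_{n+2}-2\gamma_{n+1}+\gamma_n\ge 0\quad\text{for all } n\ge 0.$$ Let $F\in X_\gamma$ have a finite number of zeros inside the unit disc $\mathbb{D}$, labeled $\alpha_1,\dots,\alpha_m$ (listed with multiplicity), with Blaschke decomposition $F=B\cdot G$. Then $$\|G(e^{i\cdot})\|_{X_\gamma}^2\le \|F(e^{i\cdot})\|_{X_\gamma}^2-\sum_{j=1}^m\left((1-|\alpha_j|^2)\left\|\frac{G(e^{i\cdot})}{1-\overline{\alpha_j}e^{i\cdot}}\right\|_{Y_\gamma}^2\right).$$
   Context: $\mathbb{D}$ is the open unit disc and $\mathcal{H}^2=\mathcal{H}^2(\mathbb{D})$ is the Hardy space of analytic functions $F(z)=\sum_{n\ge0}a_nz^n$ on $\mathbb{D}$ with $\|F\|_{\mathcal{H}^2}^2=\sum_{n\ge0}|a_n|^2<\infty$. ''Monotone increasing'' means nondecreasing. Given such a sequence $\gamma$ with $\gamma_0=0$, $\gamma\not\equiv0$, for $F(z)=\sum_{j\ge0}a_jz^j\in\mathcal{H}^2$ put $$\|F\|_{X_\gamma}^2=\sum_{j\ge0}\gamma_j|a_j|^2,\qquad \|F\|_{Y_\gamma}^2=\sum_{j\ge0}(\gamma_{j+1}-\gamma_j)|a_j|^2,$$ and $X_\gamma$ (resp. $Y_\gamma$) is the set of $F\in\mathcal{H}^2$ for which the first (resp. second) quantity is finite. A function $h(e^{i\cdot})$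 on the circle is identified with the analytic function $h(z)$ on $\mathbb{D}$ of which it is the boundary function; norms are computed from the Taylor coefficients of $h$. Blaschke decomposition: if $F$ has zeros $\alpha_1,\dots,\alpha_m$ in $\mathbb{D}$ (repeated according to multiplicity), then $F=B\cdot G$ with $B(z)=\prod_{j=1}^m\frac{z-\alpha_j}{1-\overline{\alpha_j}z}$ and $G\in\mathcal{H}^2$ without zeros in $\mathbb{D}$ ($B$ and $G$ are determined up to a unimodular constant, which does not affect the norms). *)

(* Defs.v *)
From HB Require Import structures.
From mathcomp Require Export all_boot all_order all_algebra.
From mathcomp Require Export complex.
From mathcomp Require Export boolp classical_sets reals ereal.
From mathcomp Require Export topology normedtype sequences.
Export Order.TTheory GRing.Theory Num.Theory.
Export numFieldNormedType.Exports.

Set Implicit Arguments.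
Unset Strict Implicit.
Unset Printing Implicit Defensive.

Local Open Scope classical_set_scope.
Local Open Scope ring_scope.

(* In [R[i]] the modulus [`|z|] is again complex; this is its real value. *)
Definition cmod (R : realType) (z : R[i]) : R := complex.Re `|z|.

Definition in_disc (R : realType) (z : R[i]) : Prop := cmod z < 1.

(* The type [R[i]^o] is [R[i]] with the topology of the modulus.
   A function on the disc is a total function [R[i] -> R[i]] of which only the
   values at points of the disc are ever used. *)
Definition power_series_of (R : realType) (h : R[i] -> R[i])
    (a : nat -> R[i]) : Prop :=
  forall z, in_disc z ->
    series (fun n => a n * z ^+ n : R[i]^o) @ \oo --> (h z : R[i]^o).

Definition analytic_disc (R : realType) (h : R[i] -> R[i]) : Prop :=
  exists a, power_series_of h a.

(* For [h] analytic on the disc these are the Taylor coefficients of [h] at 0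
   (they are unique); for any other [h] the sequence is 0 by convention. *)
Definition taylor (R : realType) (h : R[i] -> R[i]) : nat -> R[i] :=
  xget (fun=> 0) [set a | power_series_of h a].

Definition hardy2 (R : realType) (h : R[i] -> R[i]) : Prop :=
  analytic_disc h /\
  (\sum_(0 <= n <oo) (cmod (taylor h n) ^+ 2)%:E < +oo)%E.

(* For nondecreasing [gamma] with [gamma 0 = 0] both series below have
   nonnegative terms, so that they always have a value, possibly +oo. *)
Definition normX2 (R : realType) (gamma : nat -> R) (h : R[i] -> R[i])
    : \bar R :=
  (\sum_(0 <= j <oo) (gamma j * cmod (taylor h j) ^+ 2)%:E)%E.

Definition normY2 (R : realType) (gamma : nat -> R) (h : R[i] -> R[i])
    : \bar R :=
  (\sum_(0 <= j <oo)
     ((gamma j.+1 - gamma j) * cmod (taylor h j) ^+ 2)%:E)%E.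

Definition in_X (R : realType) (gamma : nat -> R) (h : R[i] -> R[i]) : Prop :=
  hardy2 h /\ (normX2 gamma h < +oo)%E.

Definition vanishes_to_order (R : realType) (F : R[i] -> R[i]) (w : R[i])
    (k : nat) : Prop :=
  exists g : R[i] -> R[i], [/\ analytic_disc g, g w != 0 &
    forall z, in_disc z -> F z = (z - w) ^+ k * g z].

(* [alpha] lists the zeros of [F] in the disc, with multiplicity; [k = 0] in
   [vanishes_to_order] means that [w] is not a zero. *)
Definition zeros_in_disc (R : realType) (F : R[i] -> R[i]) (m : nat)
    (alpha : 'I_m -> R[i]) : Prop :=
  (forall j, in_disc (alpha j)) /\
  (forall w, in_disc w ->
     vanishes_to_order F w #|[set j : 'I_m | alpha j == w]%SET|).

Definition blaschke (R : realType) (m : nat) (alpha : 'I_m -> R[i])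
    (z : R[i]) : R[i] :=
  \prod_(j < m) ((z - alpha j) / (1 - conjc (alpha j) * z)).

Definition blaschke_decomposition (R : realType) (F : R[i] -> R[i]) (m : nat)
    (alpha : 'I_m -> R[i]) (G : R[i] -> R[i]) : Prop :=
  [/\ hardy2 G,
      forall z, in_disc z -> G z != 0 &
      forall z, in_disc z -> F z = blaschke alpha z * G z].

(* Main.v *)
(* Take one Blaschke factor, F = (z - a) / (1 - conj a * z) * H, and put
   K = H / (1 - conj a * z), with Taylor coefficients k_n.  Then
   F_n = k_(n-1) - a k_n and H_n = k_n - conj a k_(n-1), so that
   |F_n|^2 - |H_n|^2 = (1 - |a|^2) (|k_(n-1)|^2 - |k_n|^2).
   Summing by parts against a nondecreasing nonnegative weight w gives
   sum w_n |H_n|^2 + (1 - |a|^2) sum (w_(n+1) - w_n) |k_n|^2 <= sum w_n |F_n|^2.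
   With w = gamma this strips one zero off F.  With w_n = gamma_(n+1) - gamma_n,
   which is nondecreasing by convexity, it shows that Blaschke factors do not
   decrease the Y-norm, so the remaining factors in the Y-norms may be dropped;
   an induction on the number of zeros concludes. *)
Require Import Defs.
From mathcomp Require Import ring lra.

Set Implicit Arguments.
Unset Strict Implicit.
Unset Printing Implicit Defensive.

Import Normc.
Local Open Scope classical_set_scope.
Local Open Scope ring_scope.

(** * The real-valued modulus on [R[i]] and limits of null sequences *)

Section Cmod.
Variable R : realType.
Implicit Types x y z : R[i].

Lemma cmodE z : cmod z = normc z. Proof. by case: z. Qed.
Lemma cmodC z : `|z| = (cmod z)%:C%C. Proof. by case: z. Qed.
Lemma cmod_ge0 z : 0 <= cmod z. Proof. by rewrite -ler0c -cmodC. Qed.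
Lemma cmodM x y : cmod (x * y) = cmod x * cmod y.
Proof. by rewrite !cmodE normcM. Qed.
Lemma cmodX z n : cmod (z ^+ n) = cmod z ^+ n.
Proof.
elim: n => [|n IH]; first by rewrite !expr0 cmodE normc1.
by rewrite !exprS cmodM IH.
Qed.
Lemma cmodD x y : cmod (x + y) <= cmod x + cmod y.
Proof. by rewrite !cmodE le_normcD. Qed.
Lemma cmodN x : cmod (- x) = cmod x.
Proof. by rewrite !cmodE normcN. Qed.
Lemma cmod_conj x : cmod (conjc x) = cmod x.
Proof. by rewrite !cmodE; case: x => a b /=; rewrite sqrrN. Qed.
Lemma cmod_eq0 x : cmod x = 0 -> x = 0.
Proof. by rewrite cmodE => /eq0_normc. Qed.
Lemma cmod_real (t : R) : 0 <= t -> cmod t%:C%C = t.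
Proof. by move=> t0; rewrite cmodE /= expr0n addr0 sqrtr_sqr ger0_norm. Qed.

(** Both squares have the same cross term, twice the real part of [a * x * conjc y], so it
    cancels. *)
Lemma cmod2_blaschke (a x y : R[i]) :
  cmod (y - a * x) ^+ 2 - cmod (x - conjc a * y) ^+ 2 =
  (1 - cmod a ^+ 2) * (cmod y ^+ 2 - cmod x ^+ 2).
Proof.
rewrite !cmodE; case: a x y => [a b] [x x'] [y y'] /=.
by rewrite !sqr_sqrtr ?addr_ge0 ?sqr_ge0 //; ring.
Qed.

Lemma cvg_cmod (u : nat -> R[i]) (l : R[i]) :
  (u : nat -> R[i]^o) @ \oo --> (l : R[i]^o) <->
  (fun n => cmod (u n - l)) @ \oo --> (0 : R).
Proof.
split.
- move/cvgrPdist_lt => h; apply/cvgrPdist_lt => e e0.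
  have e0' : 0 < e%:C%C by rewrite ltcR.
  near=> n; rewrite sub0r normrN ger0_norm ?cmod_ge0 // -ltcR -cmodC distrC.
  by near: n; exact: h.
- move/cvgrPdist_lt => h; apply/cvgrPdist_lt => e e0.
  (* A positive element of [R[i]] is real, so the radius [e] equals its real part. *)
  have Ree : (complex.Re e)%:C%C = e by apply: RRe_real; exact: gtr0_real.
  have e0' : 0 < complex.Re e by rewrite -ltcR Ree.
  near=> n; rewrite distrC (cmodC (u n - l)) -Ree ltcR.
  have : `|0 - cmod (u n - l)| < complex.Re e by near: n; exact: h.
  by rewrite sub0r normrN ger0_norm ?cmod_ge0.
Unshelve. all: by end_near. Qed.

(** Once [h] stays below [e * (1 - r) / 2], the recursion is dominated by an affine map with fixed
    point [e / 2], so [c] exceeds [e / 2] by at most a geometric term. *)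
Lemma contraction_cvg0 (r : R) (c h : nat -> R) : 0 <= r < 1 ->
  (forall n, 0 <= c n) -> (forall n, c n.+1 <= h n.+1 + r * c n) ->
  h @ \oo --> 0 -> c @ \oo --> 0.
Proof.
move=> /andP[r0 r1] c0 ch /cvgrPdist_lt hh; apply/cvgrPdist_lt => e e0.
have e1 : 0 < e * (1 - r) / 2 by rewrite divr_gt0 // mulr_gt0 // subr_gt0.
have [N _ hN] := hh _ e1.
have bound i : c (i + N)%N <= e / 2 + c N * r ^+ i.
  elim: i => [|i IH]; first by rewrite add0n expr0 mulr1; lra.
  have := ch (i + N)%N; have := hN (i + N).+1 (leq_trans (leq_addl i N) (leqnSn _)).
  rewrite /= sub0r normrN => /(le_lt_trans (ler_norm _)) h1 h2.
  have h3 := ler_wpM2l r0 IH; rewrite addSn exprS; nra.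
have : geometric (c N) r @ \oo --> 0 by apply: cvg_geometric; rewrite ger0_norm.
move/cvgrPdist_lt => /(_ (e / 2)) [|M _ hM]; first by rewrite divr_gt0.
exists (M + N)%N => // n /= MNn; rewrite sub0r normrN ger0_norm //.
have := hM (n - N)%N; rewrite /= leq_subRL ?(leq_trans (leq_addl _ _) MNn) //.
rewrite addnC => /(_ MNn); rewrite sub0r normrN => /(le_lt_trans (ler_norm _)) h1.
have := bound (n - N)%N; rewrite subnK ?(leq_trans (leq_addl _ _) MNn) //.
lra.
Qed.
End Cmod.

(** Multiplication by [z] on coefficients; the value 0 at index 0 stands for the coefficient of
    index -1. *)
Definition delay (V : nmodType) (a : nat -> V) (n : nat) : V :=
  if n is n'.+1 then a n' else 0.

(** * Power series of Blaschke factors and of quotients by [1 - conjc w * z] *)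

Section PowerSeries.
Variable R : realType.
Implicit Types (a b : nat -> R[i]) (w z : R[i]).

(* Coefficients of [h z / (1 - conjc w * z)] when [a] are those of [h]. *)
Fixpoint geom_div w a (n : nat) : R[i] :=
  if n is n'.+1 then a n + conjc w * geom_div w a n' else a 0%N.

Lemma geom_divK w a n :
  geom_div w a n - conjc w * delay (geom_div w a) n = a n.
Proof. by case: n => [|n] /=; rewrite ?mulr0 ?subr0 ?addrK. Qed.

Lemma geom_div_cvg0 w a : in_disc w -> (fun n => cmod (a n)) @ \oo --> (0 : R) ->
  (fun n => cmod (geom_div w a n)) @ \oo --> (0 : R).
Proof.
move=> w1 a0; apply: (contraction_cvg0 (r := cmod w) _ _ _ a0).
- by rewrite cmod_ge0.
- by move=> n; exact: cmod_ge0.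
- by move=> n /=; rewrite (le_trans (cmodD _ _))// cmodM cmod_conj.
Qed.

Lemma blaschke_factor_cvg0 w a : in_disc w ->
  (fun n => cmod (a n)) @ \oo --> (0 : R) ->
  (fun n => cmod (delay (geom_div w a) n - w * geom_div w a n)) @ \oo --> (0 : R).
Proof.
move=> w1 a0; have k0 := geom_div_cvg0 w1 a0.
have s0 : (fun n => cmod (delay (geom_div w a) n)) @ \oo --> (0 : R).
  by rewrite -(cvg_shiftS (fun n => cmod (delay (geom_div w a) n))) /= .
apply: (@squeeze_cvgr _ _ _ _ (fun=> 0)
  (fun n => cmod (delay (geom_div w a) n) + cmod w * cmod (geom_div w a n))).
- apply: nearW => n; rewrite cmod_ge0 /= -cmodM.
  by rewrite (le_trans (cmodD _ _))// cmodN.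
- exact: cvg_cst.
- rewrite -[0]addr0 -[X in _ + X](mulr0 (cmod w)).
  by apply: cvgD => //; exact: cvgMl_tmp.
Qed.

Lemma denom_neq0 w z : in_disc w -> in_disc z -> 1 - conjc w * z != 0.
Proof.
rewrite /in_disc => w1 z1; apply/eqP => /subr0_eq E.
have : cmod (conjc w * z) = 1 by rewrite -E cmodE normc1.
have := cmod_ge0 w; have := cmod_ge0 z.
by rewrite cmodM cmod_conj; nra.
Qed.

(** The recursion of [geom_div] telescopes, leaving one boundary term to be controlled in the
    limit. *)
Lemma geom_div_sum w a z n :
  (\sum_(0 <= i < n.+1) geom_div w a i * z ^+ i) * (1 - conjc w * z) =
  \sum_(0 <= i < n.+1) a i * z ^+ i - conjc w * geom_div w a n * z ^+ n.+1.
Proof.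
elim: n => [|n IH]; first by rewrite !big_nat1 /= expr0 expr1; ring.
rewrite [in LHS]big_nat_recr // [in RHS]big_nat_recr // mulrDl IH /= !exprS.
ring.
Qed.

Lemma mulXsub_sum w a z n :
  \sum_(0 <= i < n.+1) (delay a i - w * a i) * z ^+ i =
  z * (\sum_(0 <= i < n) a i * z ^+ i) - w * (\sum_(0 <= i < n.+1) a i * z ^+ i).
Proof.
elim: n => [|n IH].
  by rewrite !big_nat1 big_geq //= mulr0 !sub0r !mulrA mulNr.
rewrite big_nat_recr // IH [in RHS]big_nat_recr //.
rewrite [X in _ = _ - w * X]big_nat_recr //= !exprS; ring.
Qed.

Lemma power_series_geom_div (h : R[i] -> R[i]) w a : in_disc w ->
  (fun n => cmod (a n)) @ \oo --> (0 : R) -> power_series_of h a ->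
  power_series_of (fun z => h z / (1 - conjc w * z)) (geom_div w a).
Proof.
move=> w1 a0 ha z z1; have k0 := geom_div_cvg0 w1 a0.
have nz := denom_neq0 w1 z1.
set k := geom_div w a.
have E n : series (fun n => k n * z ^+ n : R[i]^o) n.+1 =
   (series (fun n => a n * z ^+ n : R[i]^o) n.+1 - conjc w * k n * z ^+ n.+1)
   * (1 - conjc w * z)^-1.
  apply: (canRL (mulfK nz)).
  exact: geom_div_sum.
rewrite -cvg_shiftS (eq_cvg _ _ E).
apply: cvgMr_tmp; rewrite -[h z]subr0; apply: cvgB.
  by rewrite (cvg_shiftS (series (fun n => a n * z ^+ n : R[i]^o))); exact: ha.
(* The boundary term is at most [cmod (k n)], since [w] and [z] have modulus below 1. *)
apply/cvg_cmod; apply: (@squeeze_cvgr _ _ _ _ (fun=> 0) (fun n => cmod (k n))) => //.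
  apply: nearW => n; rewrite subr0 cmod_ge0 /= !cmodM cmod_conj cmodX.
  have ? : cmod z ^+ n.+1 <= 1 by rewrite exprn_ile1 ?cmod_ge0 // ltW.
  have ? : 0 <= cmod z ^+ n.+1 by rewrite exprn_ge0 ?cmod_ge0.
  have := cmod_ge0 (k n); have := cmod_ge0 w; move: w1; rewrite /in_disc => ? ? ?.
  by rewrite mulrAC ler_piMl // mulr_ile1 // ltW.
exact: cvg_cst.
Qed.

Lemma power_series_mulXsub (h : R[i] -> R[i]) w a : power_series_of h a ->
  power_series_of (fun z => (z - w) * h z) (fun n => delay a n - w * a n).
Proof.
move=> ha z z1; rewrite -cvg_shiftS.
have E n : series (fun n => (delay a n - w * a n) * z ^+ n : R[i]^o) n.+1 =
   z * series (fun n => a n * z ^+ n : R[i]^o) n -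
   w * series (fun n => a n * z ^+ n : R[i]^o) n.+1.
  exact: mulXsub_sum.
rewrite (eq_cvg _ _ E).
rewrite mulrBl; apply: cvgB; apply: cvgMl_tmp; first exact: ha.
by rewrite (cvg_shiftS (series (fun n => a n * z ^+ n : R[i]^o))); exact: ha.
Qed.

Lemma power_series_blaschke_factor (h : R[i] -> R[i]) w a : in_disc w ->
  (fun n => cmod (a n)) @ \oo --> (0 : R) -> power_series_of h a ->
  power_series_of (fun z => (z - w) / (1 - conjc w * z) * h z)
    (fun n => delay (geom_div w a) n - w * geom_div w a n).
Proof.
move=> w1 a0 /(power_series_geom_div w1 a0) /(@power_series_mulXsub _ w) hb.
move=> z z1; have := hb z z1.
by rewrite (mulrC (h z)) mulrA.
Qed.

(** * Uniqueness of Taylor coefficients *)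

(** Convergence at [1 / 2] gives geometric growth of the coefficients, so at a small real [t]
    everything after [a 0] is of order [t]; then [t] is made small. *)
Lemma cvg0_coef0 a :
  (forall z, z != 0 -> in_disc z ->
     series (fun n => a n * z ^+ n : R[i]^o) @ \oo --> (0 : R[i]^o)) ->
  a 0%N = 0.
Proof.
move=> h; have in_disc_real (t : R) : 0 < t < 1 ->
    t%:C%C != 0 /\ in_disc (t%:C%C : R[i]).
  move=> /andP[t0 t1]; split; last by rewrite /in_disc cmod_real // ltW.
  by apply: contraTneq t0 => -[->]; rewrite ltxx.
have [C hC] : exists C, forall n, cmod (a n) <= C * 2 ^+ n.
  have [|h0 h1] := in_disc_real (1 / 2); first by apply/andP; split; lra.
  have /cvg_cmod : (fun n => a n * (1 / 2)%:C%C ^+ n : R[i]^o) @ \oo --> (0 : R[i]^o).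
    by apply: cvg_series_cvg_0; apply: cvgP; exact: h.
  move=> /cvgP /cvg_seq_bounded [M [_ hM]]; exists (M + 1) => n.
  have := hM (M + 1) (ltr_pwDr ltr01 (lexx M)) n I; rewrite /= subr0 ger0_norm ?cmod_ge0 //.
  rewrite cmodM cmodX cmod_real ?divr_ge0 // expr_div_n expr1n mul1r.
  by rewrite ler_pdivrMr ?exprn_gt0.
have C0 : 0 <= C by have := hC 0%N; have := cmod_ge0 (a 0%N); rewrite expr0; lra.
have small (t : R) : 0 < t <= 1 / 4 -> cmod (a 0%N) <= C * (4 * t).
  move=> /andP[t0 t1]; have [|z0 z1] := in_disc_real t; first by apply/andP; split; lra.
  (* For [t <= 1 / 4], [(2 * t) ^+ n <= 4 * t * (1 / 2) ^+ n] when [n >= 1]; the last factor is the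
     sum of these powers of [1 / 2]. *)
  have bound N : cmod (series (fun n => a n * t%:C%C ^+ n : R[i]^o) N.+1 - a 0%N)
      <= C * (4 * t) * (1 - (1 / 2) ^+ N).
    elim: N => [|N IH].
      by rewrite /series /= big_nat1 expr0 mulr1 subrr cmodE normc0 subrr mulr0.
    rewrite seriesSr addrAC (le_trans (cmodD _ _)) //.
    have {}hC : cmod (a N.+1 * t%:C%C ^+ N.+1) <= C * (4 * t) * (1 / 2) ^+ N.+1.
      rewrite cmodM cmodX (cmod_real (ltW t0)).
      apply: (@le_trans _ _ (C * 2 ^+ N.+1 * t ^+ N.+1)).
        by rewrite ler_wpM2r ?exprn_ge0 // ltW.
      rewrite -!mulrA ler_wpM2l // -exprMn [in leLHS]exprS [in leRHS]exprS.
      have : (2 * t) ^+ N <= (1 / 2) ^+ N by apply: lerXn2r; rewrite ?nnegrE; lra.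
      have : 0 <= (2 * t) ^+ N by rewrite exprn_ge0 //; lra.
      nra.
    by apply: le_trans (lerD IH hC) _; rewrite [_ ^+ N.+1]exprS; lra.
  have : (fun n => cmod (series (fun n => a n * t%:C%C ^+ n : R[i]^o) n.+1 - 0))
      @ \oo --> (0 : R).
    apply/cvg_cmod; rewrite (cvg_shiftS (series _)); exact: h.
  move/cvgrPdist_lt => lim; apply/ler_addgt0Pr => e e0.
  have [N _ /(_ N (leqnn N))] := lim e e0.
  rewrite /= subr0 sub0r normrN ger0_norm ?cmod_ge0 // => hN.
  have := cmodD (series (fun n => a n * t%:C%C ^+ n : R[i]^o) N.+1)
    (- (series (fun n => a n * t%:C%C ^+ n : R[i]^o) N.+1 - a 0%N)).
  rewrite cmodN opprB addrCA subrr addr0.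
  have := bound N; have : 0 <= (1 / 2 : R) ^+ N by rewrite exprn_ge0 //; lra.
  by have := mulr_ge0 C0 (ltW t0); nra.
apply: cmod_eq0; apply/eqP; rewrite eq_le cmod_ge0 andbT leNgt; apply/negP => A0.
set A := cmod (a 0%N) in small A0.
(* The point [t = A / (4 * A + 8 * C)] is at most [1 / 4] and satisfies [C * (4 * t) < A], against
   [small]. *)
have D0 : 0 < 4 * A + 8 * C by lra.
have := small (A / (4 * A + 8 * C)); rewrite divr_gt0 //= ler_pdivrMr //.
rewrite !mulrA ler_pdivlMr //; have := mulr_gt0 A0 A0; have := mulr_ge0 C0 (ltW A0); nra.
Qed.

(** Induction by dividing the series by [z]; assuming the sum 0 only off the origin makes the
    hypothesis stable under this division. *)
Lemma power_series_eq0 a :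
  (forall z, z != 0 -> in_disc z ->
     series (fun n => a n * z ^+ n : R[i]^o) @ \oo --> (0 : R[i]^o)) ->
  forall n, a n = 0.
Proof.
move=> + n; elim: n a => [|n IH] a h; first exact: cvg0_coef0.
apply: (IH (fun n => a n.+1)) => z z0 z1.
have E m : series (fun n => a n.+1 * z ^+ n : R[i]^o) m =
    z^-1 * series (fun n => a n * z ^+ n : R[i]^o) m.+1.
  rewrite /series /= big_nat_recl // (cvg0_coef0 h) mul0r add0r big_distrr /=.
  by apply: eq_bigr => i _; rewrite exprS; field.
rewrite (eq_cvg _ _ E).
suff : (fun m => z^-1 * series (fun n => a n * z ^+ n : R[i]^o) m.+1 : R[i]^o)
    @ \oo --> (z^-1 * 0 : R[i]^o) by rewrite mulr0.
apply: cvgMl_tmp.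
by rewrite (cvg_shiftS (series (fun n => a n * z ^+ n : R[i]^o))); exact: h.
Qed.

(** [taylor] selects some expansion by choice; uniqueness, applied to the difference of two
    expansions, identifies it with [a]. *)
Lemma taylorE (h : R[i] -> R[i]) a : power_series_of h a -> taylor h = a.
Proof.
move=> ha; rewrite /taylor; case: xgetP => [b _ hb|/(_ a)]; last by [].
apply/funext => n; apply/subr0_eq.
apply: (@power_series_eq0 (fun n => b n - a n)) => z _ z1.
rewrite -(subrr (h z)).
have E : series (fun n => (b n - a n) * z ^+ n : R[i]^o) =
  series (fun n => b n * z ^+ n : R[i]^o) \- series (fun n => a n * z ^+ n : R[i]^o).
  apply/funext => n'; rewrite /series /= -sumrB.
  by apply: eq_bigr => i _; rewrite mulrBl.
by rewrite E; apply: cvgB; [exact: hb|exact: ha].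
Qed.

End PowerSeries.

(** * Weighted summation by parts and the inequality for one Blaschke factor *)

Section Weighted.
Variable R : realType.

(* Summation by parts for the truncated weight [w (minn n M)], which makes the
   boundary term [c * w M * p (M + N)] vanish as [N] grows even if [w] is
   unbounded. *)
Lemma abel_truncated (w x y p : nat -> R) (c : R) (M N : nat) :
  (forall n, w n <= w n.+1) -> (forall n, 0 <= w n) ->
  (forall n, 0 <= x n) -> (forall n, 0 <= y n) ->
  (forall n, y n - x n = c * (delay p n - p n)) ->
  \sum_(0 <= n < M) (w n * x n + c * ((w n.+1 - w n) * p n)) <=
  \sum_(0 <= n < (M + N).+1) w n * y n + c * w M * p (M + N)%N.
Proof.
move=> wi w0 x0 y0 xy.
have wM N' : w M <= w (M + N')%N.
  by elim: N' => [|k IH]; rewrite ?addn0 // addnS (le_trans IH).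
elim: N => [|N IH].
  (* Adding the nonnegative term [w M * x M] turns the case [N = 0] into an exact identity, proved
     by induction on [M]. *)
  rewrite addn0; apply: (@le_trans _ _
    (\sum_(0 <= n < M) (w n * x n + c * ((w n.+1 - w n) * p n)) + w M * x M)).
    by rewrite lerDl mulr_ge0.
  rewrite le_eqVlt; apply/orP; left; apply/eqP.
  have {}xy n : y n = x n + c * (delay p n - p n) by rewrite -xy; ring.
  elim: M {wM} => [|M IH]; first by rewrite big_nat1 big_geq // xy /=; ring.
  rewrite big_nat_recr //= [in RHS]big_nat_recr //= xy /=.
  move: IH; set S := \sum_(0 <= i < M) _; set T := \sum_(0 <= i < M.+1) _.
  move=> /(canRL (addrK _)) ->; ring.
apply: (le_trans IH); rewrite addnS [in leRHS]big_nat_recr //= -subr_ge0.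
have := xy (M + N).+1; rewrite /= => E.
have := wM N.+1; rewrite addnS => wle.
(* The growth of the right side from [N] to [N + 1], written as a sum of two nonnegative terms. *)
rewrite [X in 0 <= X](_ : _ = (w (M + N).+1 - w M) * y (M + N).+1 +
    w M * x (M + N).+1); last first.
  set S := \sum_(0 <= i < _) _.
  have -> : x (M + N).+1 = y (M + N).+1 - c * (p (M + N)%N - p (M + N).+1).
    by rewrite -E; ring.
  ring.
by rewrite addr_ge0 ?mulr_ge0 // subr_ge0.
Qed.

Lemma nneseries_abel (w x y p : nat -> R) (c : R) : 0 <= c ->
  (forall n, w n <= w n.+1) -> (forall n, 0 <= w n) ->
  (forall n, 0 <= x n) -> (forall n, 0 <= y n) -> (forall n, 0 <= p n) ->
  (forall n, y n - x n = c * (delay p n - p n)) ->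
  p @ \oo --> 0 ->
  (\sum_(0 <= n <oo) (w n * x n)%:E +
    c%:E * \sum_(0 <= n <oo) ((w n.+1 - w n) * p n)%:E <=
   \sum_(0 <= n <oo) (w n * y n)%:E)%E.
Proof.
move=> c0 wi w0 x0 y0 p0 xy plim.
have dw n : 0 <= (w n.+1 - w n) * p n by rewrite mulr_ge0 // subr_ge0.
rewrite -nneseriesZl; last by move=> n _; rewrite lee_fin.
rewrite -nneseriesD; last 2 first.
- by move=> n _ _; rewrite lee_fin mulr_ge0.
- by move=> n _ _; rewrite -EFinM lee_fin mulr_ge0.
apply: lime_le.
  apply: is_cvg_nneseries => n _ _.
  by rewrite -EFinM -EFinD lee_fin; apply: addr_ge0; apply: mulr_ge0.
apply: nearW => M; rewrite sumEFin.
apply/lee_addgt0Pr => e e0.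
(* [M] is fixed before [N] is chosen, so [c * w M] is a constant and the boundary term drops below
   [e]. *)
have : (fun n => c * w M * p n) @ \oo --> 0.
  by rewrite -(mulr0 (c * w M)); exact: cvgMl_tmp.
move/cvgrPdist_lt => /(_ e e0) [N _ /(_ (M + N)%N (leq_addl _ _))].
rewrite /= sub0r normrN => /(le_lt_trans (ler_norm _)) /ltW hN.
apply: (@le_trans _ _ (\sum_(0 <= n < (M + N).+1) (w n * y n)%:E + e%:E)%E); last first.
  apply: leeD => //; apply: nneseries_lim_ge => n _ _.
  by rewrite lee_fin mulr_ge0.
rewrite sumEFin -EFinD lee_fin.
by apply: (le_trans (abel_truncated M N wi w0 x0 y0 xy)); rewrite lerD2l.
Qed.

(** Common form of [normX2] and [normY2]: the weight is [gamma] or its sequence of increments. *)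
Definition weighted2 (w : nat -> R) (h : R[i] -> R[i]) : \bar R :=
  (\sum_(0 <= n <oo) (w n * cmod (taylor h n) ^+ 2)%:E)%E.

(* Vanishing coefficients suffice here, and unlike square summability they are
   stable under division by [1 - conjc a * z] with no norm estimate. *)
Definition null_power_series (h : R[i] -> R[i]) : Prop :=
  exists2 a, power_series_of h a & (fun n => cmod (a n)) @ \oo --> (0 : R).

Lemma one_sub_cmod2_ge0 (a : R[i]) : in_disc a -> 0 <= 1 - cmod a ^+ 2.
Proof. by move=> a1; rewrite subr_ge0 expr_le1 ?cmod_ge0 //; exact: ltW. Qed.

Lemma weighted2_blaschke_factor (w : nat -> R) (h : R[i] -> R[i]) (a : R[i]) :
  (forall n, w n <= w n.+1) -> (forall n, 0 <= w n) ->
  in_disc a -> null_power_series h ->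
  (weighted2 w h + (1 - cmod a ^+ 2)%:E *
     weighted2 (fun n => (w n.+1 - w n)%R) (fun z => h z / (1 - conjc a * z))%R <=
   weighted2 w (fun z => (z - a) / (1 - conjc a * z) * h z)%R)%E.
Proof.
move=> wi w0 a1 [u hu u0]; rewrite /weighted2 (taylorE hu).
rewrite (taylorE (power_series_geom_div a1 u0 hu)).
rewrite (taylorE (power_series_blaschke_factor a1 u0 hu)).
have k0 := geom_div_cvg0 a1 u0.
apply: nneseries_abel => //; try by move=> n; rewrite sqr_ge0.
- exact: one_sub_cmod2_ge0.
- move=> n; rewrite -[in cmod (u n)](geom_divK a u n) cmod2_blaschke.
  (* At index 0 the default of [delay] is 0 both before and after taking squared moduli. *)
  by congr (_ * (_ - _)); case: n => //=; rewrite cmodE normc0 expr0n.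
- by rewrite -(mulr0 0); apply: cvgM.
Qed.

Lemma null_power_series_blaschke_factor (h : R[i] -> R[i]) (a : R[i]) :
  in_disc a -> null_power_series h ->
  null_power_series (fun z => (z - a) / (1 - conjc a * z) * h z).
Proof.
move=> a1 [u hu u0]; eexists; first exact: power_series_blaschke_factor hu.
exact: blaschke_factor_cvg0.
Qed.

Lemma null_power_series_geom (h : R[i] -> R[i]) (a : R[i]) :
  in_disc a -> null_power_series h ->
  null_power_series (fun z => h z / (1 - conjc a * z)).
Proof.
move=> a1 [u hu u0]; eexists; first exact: power_series_geom_div hu.
exact: geom_div_cvg0.
Qed.

Lemma weighted2_ge0 (w : nat -> R) (h : R[i] -> R[i]) :
  (forall n, 0 <= w n) -> (0 <= weighted2 w h)%E.
Proof.
by move=> w0; apply: nneseries_ge0 => n _ _; rewrite lee_fin mulr_ge0 ?sqr_ge0.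
Qed.

(** * Finite Blaschke products *)

(** Indexing by a list lets an induction strip one factor at a time. *)
Definition blaschke_seq (s : seq R[i]) (z : R[i]) : R[i] :=
  \prod_(a <- s) ((z - a) / (1 - conjc a * z)).

Lemma blaschke_seq_cons a s (h : R[i] -> R[i]) :
  (fun z => blaschke_seq (a :: s) z * h z) =
  (fun z => (z - a) / (1 - conjc a * z) * (blaschke_seq s z * h z)).
Proof. by apply/funext => z; rewrite /blaschke_seq big_cons !mulrA. Qed.

Lemma blaschke_seq_nil (h : R[i] -> R[i]) : (fun z => blaschke_seq [::] z * h z) = h.
Proof. by apply/funext => z; rewrite /blaschke_seq big_nil mul1r. Qed.

Lemma null_power_series_blaschke_seq (h : R[i] -> R[i]) (s : seq R[i]) :
  {in s, forall a, in_disc a} -> null_power_series h ->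
  null_power_series (fun z => blaschke_seq s z * h z).
Proof.
move=> + h0; elim: s => [|a s IH] s1; first by rewrite blaschke_seq_nil.
rewrite blaschke_seq_cons; apply: null_power_series_blaschke_factor.
  by apply: s1; rewrite mem_head.
by apply: IH => b bs; apply: s1; rewrite inE bs orbT.
Qed.

(** The one-factor inequality with its nonnegative increment term discarded, iterated over the
    list. *)
Lemma weighted2_blaschke_seq_ge (w : nat -> R) (h : R[i] -> R[i]) (s : seq R[i]) :
  (forall n, w n <= w n.+1) -> (forall n, 0 <= w n) ->
  {in s, forall a, in_disc a} -> null_power_series h ->
  (weighted2 w h <= weighted2 w (fun z => (blaschke_seq s z * h z)%R))%E.
Proof.
move=> wi w0 + h0; elim: s => [|a s IH] s1; first by rewrite blaschke_seq_nil.
have a1 : in_disc a by apply: s1; rewrite mem_head.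
have {}s1 : {in s, forall a, in_disc a}.
  by move=> b bs; apply: s1; rewrite inE bs orbT.
rewrite blaschke_seq_cons; apply: le_trans (IH s1) _.
apply: le_trans (weighted2_blaschke_factor wi w0 a1 (null_power_series_blaschke_seq s1 h0)).
rewrite leeDl // mule_ge0 ?weighted2_ge0 // => [|n]; last by rewrite subr_ge0.
by rewrite lee_fin one_sub_cmod2_ge0.
Qed.

(** Stripping the head [a] leaves the increment norm of the remaining product times
    [h / (1 - conjc a * z)]; the increments are nondecreasing, so [weighted2_blaschke_seq_ge]
    removes that product. *)
Lemma weighted2_blaschke_seq (w : nat -> R) (h : R[i] -> R[i]) (s : seq R[i]) :
  (forall n, w n <= w n.+1) -> (forall n, 0 <= w n) ->
  (forall n, w n.+1 - w n <= w n.+2 - w n.+1) ->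
  {in s, forall a, in_disc a} -> null_power_series h ->
  (weighted2 w h + \sum_(a <- s) ((1 - cmod a ^+ 2)%:E *
     weighted2 (fun n => (w n.+1 - w n)%R) (fun z => h z / (1 - conjc a * z))%R) <=
   weighted2 w (fun z => (blaschke_seq s z * h z)%R))%E.
Proof.
move=> wi w0 wc + h0; elim: s => [|a s IH] s1.
  by rewrite blaschke_seq_nil big_nil adde0.
have a1 : in_disc a by apply: s1; rewrite mem_head.
have {}s1 : {in s, forall a, in_disc a}.
  by move=> b bs; apply: s1; rewrite inE bs orbT.
rewrite blaschke_seq_cons big_cons addeCA addeC.
apply: le_trans (weighted2_blaschke_factor wi w0 a1 (null_power_series_blaschke_seq s1 h0)).
apply: leeD; first exact: IH.
apply: lee_wpmul2l.
  by rewrite lee_fin one_sub_cmod2_ge0.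
have -> : (fun z => blaschke_seq s z * h z / (1 - conjc a * z)) =
    (fun z => blaschke_seq s z * (h z / (1 - conjc a * z))).
  by apply/funext => z; rewrite mulrA.
apply: weighted2_blaschke_seq_ge s1 (null_power_series_geom a1 h0); first exact: wc.
by move=> n; rewrite subr_ge0.
Qed.

(** * Passage from the Hardy space to the theorem *)

Lemma hardy2_null_power_series (h : R[i] -> R[i]) :
  hardy2 h -> null_power_series h.
Proof.
move=> [[a ha]]; rewrite (taylorE ha) => fin; exists a => //.
have /nnseries_is_cvg /(_ fin) /cvg_series_cvg_0 /cvgrPdist_lt lim :
  forall n, 0 <= cmod (a n) ^+ 2 by move=> n; rewrite sqr_ge0.
apply/cvgrPdist_lt => e e0; have := lim (e ^+ 2) (exprn_gt0 2 e0).
apply: filterS => n; rewrite !sub0r !normrN normrX.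
by rewrite ltr_pXn2r ?nnegrE // ltW.
Qed.

(** [power_series_of] reads values on the disc only, and that is where the factorization of [F] is
    given. *)
Lemma eq_taylor (h g : R[i] -> R[i]) :
  (forall z, in_disc z -> h z = g z) -> taylor h = taylor g.
Proof.
move=> hg; suff E : power_series_of h = power_series_of g by rewrite /taylor E.
apply/funext => a; apply/propext.
by split=> H z z1; [rewrite -(hg z z1)|rewrite (hg z z1)]; exact: H.
Qed.

End Weighted.

Theorem theorem2 (R : realType) (gamma : nat -> R)
    (gamma_incr : forall n, gamma n <= gamma n.+1)
    (gamma_nz : exists n, gamma n != 0)
    (gamma_0 : gamma 0%N = 0)
    (gamma_convex : forall n, 0 <= gamma n.+2 - 2 * gamma n.+1 + gamma n)
    (F : R[i] -> R[i]) (F_in_X : in_X gamma F)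
    (m : nat) (alpha : 'I_m -> R[i]) (F_zeros : zeros_in_disc F alpha)
    (G : R[i] -> R[i]) (F_BG : blaschke_decomposition F alpha G) :
  (normX2 gamma G <=
   normX2 gamma F
   - \sum_(j < m) ((1 - cmod (alpha j) ^+ 2)%:E
        * normY2 gamma (fun z => G z / (1 - conjc (alpha j) * z)%R)%R))%E.
Proof.
case: F_BG => /hardy2_null_power_series G0 _ FG.
have gamma_ge0 n : 0 <= gamma n.
  by elim: n => [|n IH]; rewrite ?gamma_0 // (le_trans IH).
have dgamma n : gamma n.+1 - gamma n <= gamma n.+2 - gamma n.+1.
  by have := gamma_convex n; lra.
pose s := [seq alpha j | j <- enum 'I_m].
have s1 : {in s, forall a, in_disc a}.
  by move=> _ /mapP[j _ ->]; case: F_zeros => + _; exact.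
have /eq_taylor FE : forall z, in_disc z -> F z = blaschke_seq s z * G z.
  by move=> z /FG ->; rewrite /blaschke /blaschke_seq big_map big_enum.
have := weighted2_blaschke_seq gamma_incr gamma_ge0 dgamma s1 G0.
rewrite big_map big_enum /= {3}/weighted2 -FE -/(normX2 gamma F).
set S := (\sum_(i < m) _)%E => le.
have X0 : (0 <= normX2 gamma G)%E by exact: weighted2_ge0.
have FX : normX2 gamma F \is a fin_num.
  rewrite ge0_fin_numE; [exact: (proj2 F_in_X)|exact: weighted2_ge0].
have S0 : (0 <= S)%E.
  apply: sume_ge0 => j _; apply: mule_ge0.
    by rewrite lee_fin; exact: one_sub_cmod2_ge0 (proj1 F_zeros j).
  by apply: weighted2_ge0 => n; rewrite subr_ge0.
(* [S] is bounded by the finite norm of [F]; its finiteness allows the subtraction in the extended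
   reals. *)
have SX : S \is a fin_num.
  rewrite ge0_fin_numE; last exact: S0.
  apply: le_lt_trans (proj2 F_in_X).
  by apply: le_trans le; exact: leeDr.
rewrite leeBrDr; [exact: le|exact: SX].
Qed.
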